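(* Let $S$ be a semigroup. For every $x \in S$, the set $C(x)$ is (the vertex set of) a connected component of the enhanced power graph $\mathcal{P}_e(S)$. Moreover, the connected components of $\mathcal{P}_e(S)$ are precisely the sets in $\{C(x) : x \in S\}$.
   Context: $\mathbb{N}$ denotes the set of positive integers. For $z \in S$, $\langle z \rangle = \{z^m : m \in \mathbb{N}\}$ is the subsemigroup generated by $z$. The enhanced power graph $\mathcal{P}_e(S)$ of a semigroup $S$ is the simple undirected graph with vertex set $S$ in which two distinct vertices $x, y$ are adjacent if and only if $x, y \in \langle z \rangle$ for some $z \in S$. For $x \in S$ and $m, n \in \mathbb{N}$ put $S(x,m,n) = \{y \in S : x^m = y^n\}$, and $C(x) = \bigcup_{m,n \in \mathbb{N}} S(x,m,n)$. *)

(* Defs.v *)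
From HB Require Import structures.
From mathcomp Require Import all_boot.
From mathcomp Require Import boolp classical_sets.

Set Implicit Arguments.
Unset Strict Implicit.
Unset Printing Implicit Defensive.

Local Open Scope group_scope.
Local Open Scope classical_set_scope.

Record sgraph (V : Type) := SGraph {
  adj : V -> V -> Prop;
  adj_sym : forall x y, adj x y -> adj y x;
  adj_irr : forall x, ~ adj x x
}.

Section Connectedness.
Variable V : Type.
Implicit Types (G : sgraph V) (A : set V).

Definition walk G (x : V) (p : seq V) (y : V) : Prop :=
  path (fun u v => `[< adj G u v >]) x p /\ last x p = y.

Definition connected_graph G : Prop :=
  inhabited V /\ forall x y : V, exists p, walk G x p y.

Definition induced G A : sgraph {x : V | A x} :=
  @SGraph {x : V | A x} (fun x y => adj G (sval x) (sval y))
    (fun x y => @adj_sym V G (sval x) (sval y))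
    (fun x => @adj_irr V G (sval x)).

End Connectedness.

(* [A] is the vertex set of a maximal connected subgraph of [G]; such a
   subgraph is necessarily the one induced on its vertex set. *)
Definition connected_component_of (V : Type) (G : sgraph V) (A : set V) : Prop :=
  connected_graph (induced G A) /\
  forall B : set V, A `<=` B -> connected_graph (induced G B) -> B = A.

Section EnhancedPowerGraph.
Variable S : semigroupType.
Implicit Types x y z : S.

(* A semigroup need not have a unit, so the value [x] at exponent [0] is a dummy:
   only positive exponents are used below. *)
Definition spow x (n : nat) : S := iterop n *%g x x.

Definition positives : set nat := [set n | (0 < n)%N].

Definition gen z : set S := [set spow z m | m in positives].

Definition epg_adj x y : Prop := x <> y /\ exists z, gen z x /\ gen z y.

Lemma epg_adj_sym x y : epg_adj x y -> epg_adj y x.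
Proof. by move=> [neq_xy [z [zx zy]]]; split; [exact: nesym | exists z]. Qed.

Lemma epg_adj_irr x : ~ epg_adj x x.
Proof. by case. Qed.

Definition enhanced_power_graph : sgraph S := SGraph epg_adj_sym epg_adj_irr.

Definition eqpow_set x (m n : nat) : set S := [set y | spow x m = spow y n].

Definition eqpow_class x : set S :=
  \bigcup_(m in positives) \bigcup_(n in positives) eqpow_set x m n.

End EnhancedPowerGraph.

(* Main.v *)
(** Having a common positive power is an equivalence relation whose classes are
    the sets [C(x)].  Adjacent vertices are powers [z^a] and [z^b] of one element,
    hence equivalent because [(z^a)^b = (z^b)^a]; so a connected set lies in a
    single class.  Conversely, if [x^m = y^n] then [x], [x^m], [y] is a walk, up to
    repeated vertices, inside the class. *)
Require Import Defs.
From mathcomp Require Import all_boot.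
From mathcomp Require Import boolp classical_sets.

Local Open Scope classical_set_scope.

Section Walks.
Variables (V : Type) (G : sgraph V).

Lemma walk_cat x y z p q :
  walk G x p y -> walk G y q z -> walk G x (p ++ q) z.
Proof. by move=> [xp <-] [yq <-]; split; rewrite ?cat_path ?xp ?last_cat. Qed.

Lemma walk_edge x y : x = y \/ adj G x y -> exists p, walk G x p y.
Proof.
case=> [->|xy]; first by exists [::].
by exists [:: y]; split=> //=; rewrite andbT; apply/asboolP.
Qed.

Lemma walk_rel (R : V -> V -> Prop) :
    (forall x, R x x) -> (forall x y z, R x y -> R y z -> R x z) ->
    (forall x y, adj G x y -> R x y) ->
  forall p x y, walk G x p y -> R x y.
Proof.
move=> Rxx Rtr Radj; elim=> [|u p IHp] x y [/= xp <-] //.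
by case/andP: xp => /asboolP/Radj xu up; apply: Rtr xu (IHp _ _ _).
Qed.

End Walks.

Section Powers.
Variable S : semigroupType.
Implicit Types (x y z : S) (A : set S).

Lemma spowSS x n : spow x n.+2 = (x * spow x n.+1)%g.
Proof. by []. Qed.

(** Positivity matters: [spow x 0] is the dummy value [x], so at [m = 0] the right-hand side would
    have one factor too many. *)
Lemma spowD x m n :
  (0 < m)%N -> (0 < n)%N -> spow x (m + n) = (spow x m * spow x n)%g.
Proof.
case: m n => // m [] // n _ _; elim: m => [|m IHm]; first by rewrite add1n.
by rewrite addSn addSn spowSS -addSn IHm spowSS mulgA.
Qed.

Lemma spowM x m n :
  (0 < m)%N -> (0 < n)%N -> spow x (m * n) = spow (spow x m) n.
Proof.
move=> m_gt0; case: n => // n _; elim: n => [|n IHn]; first by rewrite muln1.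
by rewrite mulnS spowD ?muln_gt0 ?m_gt0 // IHn.
Qed.

Lemma eqpow_classP x y :
  eqpow_class x y <->
  exists m n, [/\ (0 < m)%N, (0 < n)%N & spow x m = spow y n].
Proof.
split=> [[m m0 [n n0 e]]|[m [n [m0 n0 e]]]]; first by exists m, n.
by exists m => //; exists n.
Qed.

Lemma eqpow_refl x : eqpow_class x x.
Proof. by apply/eqpow_classP; exists 1, 1. Qed.

Lemma eqpow_sym x y : eqpow_class x y -> eqpow_class y x.
Proof.
by move=> /eqpow_classP[m [n [m0 n0 e]]]; apply/eqpow_classP; exists n, m.
Qed.

Lemma eqpow_trans x y z :
  eqpow_class x y -> eqpow_class y z -> eqpow_class x z.
Proof.
move=> /eqpow_classP[m [n [m0 n0 exy]]] /eqpow_classP[k [l [k0 l0 eyz]]].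
(* Raise the first equation to the power [k] and the second to the power [n]: both pass through
   [spow y (n * k)]. *)
apply/eqpow_classP; exists (m * k)%N, (l * n)%N; rewrite !muln_gt0 m0 n0 k0 l0.
by split=> //; rewrite !spowM // exy -eyz -!spowM // mulnC.
Qed.

Lemma gen_eqpow z x y : gen z x -> gen z y -> eqpow_class x y.
Proof.
move=> [a a0 <-] [b b0 <-]; apply/eqpow_classP; exists b, a.
by split=> //; rewrite -!spowM // mulnC.
Qed.

Lemma gen_id x : gen x x.
Proof. by exists 1. Qed.

Lemma gen_spow x n : (0 < n)%N -> gen x (spow x n).
Proof. by move=> n0; exists n. Qed.

(** Serves twice: it makes each class maximal, and it places an arbitrary component inside a
    class. *)
Lemma connected_sub_eqpow_class A x :
    connected_graph (induced (enhanced_power_graph S) A) -> A x ->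
  A `<=` eqpow_class x.
Proof.
move=> [_ conA] Ax y Ay.
have [p] := conA (exist A x Ax) (exist A y Ay).
apply: (walk_rel _ _ (fun u v => eqpow_class (sval u) (sval v))) => [u|u v w|u v].
- exact: eqpow_refl.
- exact: eqpow_trans.
- by move=> [_ [z [zu zv]]]; exact: gen_eqpow zu zv.
Qed.

Lemma eqpow_class_connected x :
  connected_graph (induced (enhanced_power_graph S) (eqpow_class x)).
Proof.
split; first by split; exists x; exact: eqpow_refl.
have edge (u v : {y | eqpow_class x y}) z : gen z (sval u) -> gen z (sval v) ->
    exists p, walk (induced (enhanced_power_graph S) (eqpow_class x)) u p v.
  move=> zu zv; apply: walk_edge.
  (* Adjacency excludes equal vertices, so if the underlying elements coincide the walk is empty;
     the dependent pairs are then equal by proof irrelevance. *)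
  have [uv|uv] := pselect (sval u = sval v); last by right; split=> //; exists z.
  by left; case: u v uv {zu zv} => [u xu] [v xv] /=; exact: eq_exist.
move=> u v; have xu := svalP u; have xv := svalP v.
have /eqpow_classP[m [n [m0 n0 e]]] := eqpow_trans _ _ _ (eqpow_sym _ _ xu) xv.
(* The common power is the middle vertex. It must lie in the class for the walk to stay in the
   induced graph; [u] generates both ends of the first edge, [v] those of the second. *)
have xw : eqpow_class x (spow (sval u) m).
  exact: eqpow_trans xu (gen_eqpow _ _ _ (gen_id _) (gen_spow _ _ m0)).
pose w : {y | eqpow_class x y} := exist _ _ xw.
have [p uw] := edge u w (sval u) (gen_id _) (gen_spow _ _ m0).
have vw : gen (sval v) (sval w) by rewrite /= e; exact: gen_spow.
have [q wv] := edge w v (sval v) vw (gen_id _).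
by exists (p ++ q); exact: walk_cat uw wv.
Qed.

End Powers.

Theorem proposition3p1 (S : semigroupType) :
  (forall x : S,
     connected_component_of (enhanced_power_graph S) (eqpow_class x)) /\
  [set A : set S | connected_component_of (enhanced_power_graph S) A]
    = [set eqpow_class x | x in [set: S]].
Proof.
have compC (x : S) :
    connected_component_of (enhanced_power_graph S) (eqpow_class x).
  split=> [|B CB conB]; first exact: eqpow_class_connected.
  apply/seteqP; split=> //; apply: connected_sub_eqpow_class conB _.
  exact/CB/eqpow_refl.
split=> //; apply/seteqP; split=> [A [conA maxA]|_ [x _ <-]]; last exact: compC.
(* Connected graphs are nonempty, which supplies [x]; maximality of [A] is then applied to the
   connected superset [eqpow_class x]. *)
have [[[x Ax]] _] := conA; exists x => //; apply: maxA.
  exact: connected_sub_eqpow_class.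
exact: eqpow_class_connected.
Qed.
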